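(* The chromatic polynomial of the Farey graph $G_n$ ($n\ge 0$) is $$P(G_n;\lambda)=\lambda(1-\lambda)(2-\lambda)^{2^n-1}.$$
   Context: The Farey graphs $G_n$ ($n\ge 0$), each with two distinguished (''special'') vertices $X_n,Y_n$, are defined recursively. $G_0$ is a single edge joining its two special vertices $X_0$ and $Y_0$. For $n\ge 1$, take two disjoint copies $G_{n-1}^1,G_{n-1}^2$ of $G_{n-1}$, with special vertices $X_{n-1}^i,Y_{n-1}^i$ ($i=1,2$); identify $Y_{n-1}^1$ with $X_{n-1}^2$ into one vertex, and add a new edge $e_n$ joining $X_{n-1}^1$ and $Y_{n-1}^2$. The result is $G_n$, with special vertices $X_n=X_{n-1}^1$ and $Y_n=Y_{n-1}^2$. It has $2^n+1$ vertices and $2^{n+1}-1$ edges. The chromatic polynomial $P(G;\lambda)$ of a graph $G$ is the polynomial whose value at each positive integer $\lambda$ is the number of colorings of the vertices of $G$ with $\lambda$ colors such that adjacent vertices receive different colors.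
   Formalization: The printed formula has the wrong sign at n = 0 (a single edge has chromatic polynomial λ(λ-1), not λ(1-λ)); the formal theorem proves the printed formula for all n ≥ 1 and P(G_0;λ) = λ(λ-1) for n = 0. *)

(* Defs.v *)
From HB Require Import structures.
From mathcomp Require Import all_boot all_order all_algebra.

Set Implicit Arguments.
Unset Strict Implicit.
Unset Printing Implicit Defensive.

Import GRing.Theory Num.Theory.
Local Open Scope ring_scope.

Record sgraph := SGraph {
  vertex :> finType;
  adj : rel vertex;
  adj_sym : symmetric adj;
  adj_irrefl : irreflexive adj }.

Section ChromaticPolynomial.
Variable G : sgraph.

Definition proper_colorings (k : nat) : {set {ffun G -> 'I_k}} :=
  [set f : {ffun G -> 'I_k} | [forall u, forall v, adj u v ==> (f u != f v)]].

Definition is_chromatic_poly (P : {poly int}) : Prop :=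
  forall k : nat, (0 < k)%N -> P.[k%:R] = #|proper_colorings k|%:R.

End ChromaticPolynomial.

Lemma is_chromatic_poly_uniq (G : sgraph) (P Q : {poly int}) :
  is_chromatic_poly G P -> is_chromatic_poly G Q -> P = Q.
Proof.
move=> hP hQ; apply/eqP; rewrite -subr_eq0; apply/negPn/negP=> nz.
pose s : seq int := [seq (i.+1)%:R | i <- iota 0 (size (P - Q))].
have := @max_poly_roots _ (P - Q) s nz.
rewrite size_map size_iota ltnn => H; suff: false by []; apply: H.
  apply/allP=> _ /mapP[i _ ->]; apply/rootP.
  by rewrite hornerD hornerN hP // hQ // subrr.
rewrite map_inj_uniq ?iota_uniq // => i j /eqP.
by rewrite eqr_nat => /eqP[].
Qed.

(* Deletion-contraction on the list s of constraints; r is an idempotent map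
   sending each vertex to the representative of its contracted class. *)
Lemma constrained_colorings_poly (T : finType) (s : seq (T * T)) (r : T -> T) :
  (forall v, r (r v) = r v) ->
  {P : {poly int} | forall k : nat, P.[k%:R] =
    #|[set f : {ffun T -> 'I_k} | [forall v, f (r v) == f v]
                                  & all (fun e => f e.1 != f e.2) s]|%:R}.
Proof.
elim: s r => [|[a b] s IHs] r rr.
  exists 'X^(#|[pred v | r v == v]|) => k.
  rewrite hornerXn -natrX; congr (_%:R).
  rewrite -[in LHS](card_ord k) -card_sig -card_ffun.
  pose S := {v : T | [pred v | r v == v] v}.
  pose h (g : {ffun S -> 'I_k}) : {ffun T -> 'I_k} :=
    [ffun v => g (exist (fun v => [pred v | r v == v] v) (r v)
                 (introT eqP (rr v)))].
  have h_inj : injective h.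
    move=> g1 g2 /ffunP E; apply/ffunP=> -[v pv].
    move: (E v); rewrite !ffunE.
    have -> : exist (fun v => [pred v | r v == v] v) (r v)
                 (introT eqP (rr v)) = exist _ v pv.
      by apply: val_inj; apply/eqP.
    by [].
  rewrite -[LHS](card_imset _ h_inj); apply: eq_card => f; rewrite !inE andbT.
  apply/imsetP/forallP => [[g _ ->] v|fr].
    rewrite !ffunE; apply/eqP; congr (g _); apply: val_inj; exact: rr.
  exists [ffun x : S => f (val x)] => //; apply/ffunP=> v.
  by rewrite !ffunE /=; apply/esym/eqP.
pose r' v := if r v == r a then r b else r v.
have rr' v : r' (r' v) = r' v.
  rewrite /r'; case: (eqVneq (r v) (r a)) => [_|ne]; rewrite rr; first by case: ifP.
  by rewrite (negPf ne).
have [P hP] := IHs r rr; have [Q hQ] := IHs r' rr'.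
exists (P - Q) => k; rewrite hornerD hornerN hP hQ.
apply/eqP; rewrite subr_eq -natrD eqr_nat; apply/eqP.
set A := finset _; set B := finset _; set C := finset _.
rewrite -(cardsID [set f : {ffun T -> 'I_k} | f a != f b] A); congr (_ + _)%N.
  by apply: eq_card => f; rewrite !inE /= -!andbA; congr (_ && _); rewrite andbC.
apply: eq_card => f; rewrite !inE negbK andbA; congr (_ && _).
apply/andP/forallP => [[/eqP ab /forallP fr] v|fr'].
  rewrite /r'; case: (eqVneq (r v) (r a)) => [e|_]; last exact: fr.
  by rewrite (eqP (fr b)) -ab -(eqP (fr a)) -e fr.
have fab : f a = f b.
  rewrite -(eqP (fr' a)) -(eqP (fr' b)) /r' eqxx; by case: ifP.
split; first exact/eqP.
apply/forallP=> v; rewrite -(eqP (fr' v)) -(eqP (fr' (r v))) /r' rr.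
by case: ifP.
Qed.

Lemma chromatic_poly_exists (G : sgraph) : {P : {poly int} | is_chromatic_poly G P}.
Proof.
have [P hP] := @constrained_colorings_poly G
  (enum [pred e : G * G | adj e.1 e.2]) id (fun=> erefl).
exists P => k _; rewrite hP; congr (_%:R); apply: eq_card => f; rewrite !inE.
apply/andP/forallP => [[_ /allP H] u|H].
  by apply/forallP=> v; apply/implyP=> uv; apply: (H (u, v)); rewrite mem_enum.
split; first by apply/forallP.
apply/allP=> -[u v]; rewrite mem_enum /= inE /= => uv.
by have /forallP/(_ v)/implyP := H u; apply.
Qed.

(* Existence is proved opaquely: chromatic_poly is only known through
   chromatic_polyP, which determines it by is_chromatic_poly_uniq. *)
Definition chromatic_poly (G : sgraph) : {poly int} :=
  proj1_sig (chromatic_poly_exists G).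

Lemma chromatic_polyP (G : sgraph) : is_chromatic_poly G (chromatic_poly G).
Proof. exact: proj2_sig. Qed.

(* The two special vertices are kept distinct, so that the edge added by
   fstep_adj is never a loop. *)
Record st_graph := StGraph {
  st_sgraph :> sgraph;
  st_X : st_sgraph;
  st_Y : st_sgraph;
  st_XY : st_X != st_Y }.

Section FareyStep.
Variables G1 G2 : st_graph.

(* The disjoint union of G1 and G2 with st_Y G1 and st_X G2 identified: the
   merged vertex is represented by inl (st_Y G1). *)
Definition fglue : finType := (G1 + {v : G2 | v != st_X G2})%type.

Definition fglue1 (u : G1) : fglue := inl u.

Definition fglue2 (v : G2) : fglue :=
  if insub v is Some w then inr w else inl (st_Y G1).

(* Adjacencies come from either copy, or from the added edge, which joins
   st_X G1 to st_Y G2. *)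
Definition fstep_adj : rel fglue := fun x y =>
  [|| [exists u, exists v, [&& adj u v, x == fglue1 u & y == fglue1 v]],
      [exists u, exists v, [&& adj u v, x == fglue2 u & y == fglue2 v]],
      (x == fglue1 (st_X G1)) && (y == fglue2 (st_Y G2))
    | (x == fglue2 (st_Y G2)) && (y == fglue1 (st_X G1))].

Lemma fglue2_inj : injective fglue2.
Proof.
move=> u v; rewrite /fglue2.
case: insubP => [u' _ <-|]; case: insubP => [v' _ <-|] //; first by move=> [->].
by rewrite !negbK => /eqP-> /eqP->.
Qed.

Lemma fstep_XY : fglue1 (st_X G1) != fglue2 (st_Y G2).
Proof.
by rewrite /fglue1 /fglue2; case: insubP => //; rewrite negbK eq_sym (negPf (st_XY G2)).
Qed.

Lemma fstep_adj_sym : symmetric fstep_adj.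
Proof.
suff H x y : fstep_adj x y -> fstep_adj y x by move=> x y; apply/idP/idP; apply: H.
case/or4P => [||/andP[hx hy]|/andP[hx hy]]; last 2 first.
- by apply/or4P/Or44; rewrite hx hy.
- by apply/or4P/Or43; rewrite hx hy.
- case/existsP=> u /existsP[v /and3P[uv hx hy]]; apply/or4P/Or41.
  by apply/existsP; exists v; apply/existsP; exists u; rewrite adj_sym uv hx hy.
case/existsP=> u /existsP[v /and3P[uv hx hy]]; apply/or4P/Or42.
by apply/existsP; exists v; apply/existsP; exists u; rewrite adj_sym uv hx hy.
Qed.

Lemma fstep_adj_irrefl : irreflexive fstep_adj.
Proof.
move=> x; apply/negP => /or4P[||/andP[/eqP->]|/andP[/eqP->]].
- case/existsP=> u /existsP[v /and3P[uv /eqP-> /eqP[]]] uEv.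
  by move: uv; rewrite uEv adj_irrefl.
- case/existsP=> u /existsP[v /and3P[uv /eqP-> /eqP/fglue2_inj]] uEv.
  by move: uv; rewrite uEv adj_irrefl.
- by rewrite (negPf fstep_XY).
by rewrite eq_sym (negPf fstep_XY).
Qed.

Definition farey_step : st_graph :=
  @StGraph (SGraph fstep_adj_sym fstep_adj_irrefl)
           (fglue1 (st_X G1)) (fglue2 (st_Y G2)) fstep_XY.

End FareyStep.

Lemma neq_sym (T : eqType) : symmetric (fun x y : T => x != y).
Proof. by move=> x y; rewrite eq_sym. Qed.

Lemma neq_irrefl (T : eqType) : irreflexive (fun x y : T => x != y).
Proof. by move=> x; rewrite eqxx. Qed.

Definition single_edge : st_graph :=
  @StGraph (SGraph (@neq_sym bool) (@neq_irrefl bool)) false true isT.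

Fixpoint farey (n : nat) : st_graph :=
  if n is m.+1 then farey_step (farey m) (farey m) else single_edge.

(* Main.v *)
(** Fix the number k of colors and the colors a, b of the two special vertices.
    Colorings of a Farey step with a != b split, according to the color c of
    the glued vertex, into a coloring of each copy with special colors (a, c)
    and (c, b).  In G_n the special vertices are adjacent, so by induction the
    number N_n of colorings does not depend on a != b, and only the k - 2 colors
    c distinct from a and b contribute: N_(n+1) = (k - 2) N_n^2.  Summing over
    the pairs a != b gives k (k - 1) (k - 2)^(2^n - 1). *)

Require Import Defs.
From mathcomp Require Import all_boot all_order all_algebra.
From mathcomp Require Import zify.

Import GRing.Theory.
Local Open Scope ring_scope.

Definition special_colorings (G : st_graph) (k : nat) (a b : 'I_k) :
    {set {ffun G -> 'I_k}} :=
  [set f in proper_colorings G k | (f (st_X G) == a) && (f (st_Y G) == b)].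

Lemma proper_coloringP (G : sgraph) (k : nat) (f : {ffun G -> 'I_k}) :
  reflect (forall u v : G, adj u v -> f u != f v) (f \in proper_colorings G k).
Proof.
rewrite inE; apply: (iffP forallP) => [fP u v|fP u].
  by have /forallP/(_ v)/implyP := fP u.
by apply/forallP=> v; apply/implyP/fP.
Qed.

Lemma card_fibers (T I : finType) (A : {set T}) (h : T -> I) :
  #|A| = (\sum_i #|[set x in A | h x == i]|)%N.
Proof.
rewrite -sum1_card (partition_big h predT) //=; apply: eq_bigr => i _.
by rewrite -sum1_card; apply: eq_bigl => x; rewrite inE.
Qed.

Lemma card_proper_colorings (G : st_graph) (k : nat) :
  #|proper_colorings G k| =
  (\sum_(a < k) \sum_(b < k) #|special_colorings G k a b|)%N.
Proof.
rewrite (card_fibers _ _ _ (fun f : {ffun G -> 'I_k} => f (st_X G))).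
apply: eq_bigr => a _.
rewrite (card_fibers _ _ _ (fun f : {ffun G -> 'I_k} => f (st_Y G))).
by apply: eq_bigr => b _; apply: eq_card => f; rewrite !inE -!andbA.
Qed.

Section Step.
Variables (G1 G2 : st_graph) (k : nat).
Local Notation H := (farey_step G1 G2).
Local Notation g1 := (@fglue1 G1 G2).
Local Notation g2 := (@fglue2 G1 G2).

Lemma fglue2_X : g2 (st_X G2) = g1 (st_Y G1).
Proof. by rewrite /fglue2 insubF ?eqxx. Qed.

Lemma fglue2_sub (w : {v : G2 | v != st_X G2}) : g2 (val w) = inr w.
Proof. by rewrite /fglue2 valK. Qed.

Lemma farey_step_special_adj : adj (st_X H) (st_Y H).
Proof. by apply/or4P/Or43; rewrite !eqxx. Qed.

(** The hypothesis on [f] settles the added edge; every other edge is the image of an edge of one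
    copy. *)
Lemma farey_step_properP (f : {ffun H -> 'I_k}) :
  f (st_X H) != f (st_Y H) ->
  (f \in proper_colorings H k) =
  ([ffun u => f (g1 u)] \in proper_colorings G1 k)
  && ([ffun v => f (g2 v)] \in proper_colorings G2 k).
Proof.
move=> fXY; apply/proper_coloringP/andP => [fP|[/proper_coloringP f1P
  /proper_coloringP f2P] x y].
  split; apply/proper_coloringP=> u v uv; rewrite !ffunE; apply: fP.
    by apply/or4P/Or41/existsP; exists u; apply/existsP; exists v; rewrite uv !eqxx.
  by apply/or4P/Or42/existsP; exists u; apply/existsP; exists v; rewrite uv !eqxx.
case/or4P=> [||/andP[/eqP-> /eqP->]|/andP[/eqP-> /eqP->]] //; last by rewrite eq_sym.
- case/existsP=> u /existsP[v /and3P[uv /eqP-> /eqP->]].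
  by have := f1P u v uv; rewrite !ffunE.
case/existsP=> u /existsP[v /and3P[uv /eqP-> /eqP->]].
by have := f2P u v uv; rewrite !ffunE.
Qed.

Lemma card_special_colorings_step (a b : 'I_k) : a != b ->
  #|special_colorings H k a b| =
  (\sum_(c < k) #|special_colorings G1 k a c| * #|special_colorings G2 k c b|)%N.
Proof.
move=> ab; rewrite (card_fibers _ _ _ (fun f : {ffun H -> 'I_k} => f (g1 (st_Y G1)))).
apply: eq_bigr => c _; rewrite -cardsX.
(* Restriction to the two copies is injective because together they cover all vertices; it remains
   to identify the image of each fiber. *)
pose restr (f : {ffun H -> 'I_k}) :=
  ([ffun u => f (g1 u)] : {ffun G1 -> 'I_k}, [ffun v => f (g2 v)] : {ffun G2 -> 'I_k}).
have restr_inj : injective restr.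
  move=> f f' [/ffunP e1 /ffunP e2]; apply/ffunP=> -[u|w].
    by have := e1 u; rewrite !ffunE.
  by have := e2 (val w); rewrite !ffunE fglue2_sub.
have restrE f : (f \in special_colorings H k a b) && (f (g1 (st_Y G1)) == c) =
    (restr f \in setX (special_colorings G1 k a c) (special_colorings G2 k c b)).
  rewrite in_setX ![_ \in special_colorings _ _ _ _]inE !ffunE fglue2_X.
  rewrite -[g1 (st_X G1)]/(st_X H) -[g2 (st_Y G2)]/(st_Y H).
  case: (f (st_X H) =P a) => [fX|_]; last by rewrite !andbF.
  case: (f (st_Y H) =P b) => [fY|_]; last by rewrite !andbF.
  rewrite farey_step_properP ?fX ?fY // !andbT !andTb.
  by case: (_ == c); rewrite ?andbT ?andbF.
rewrite -(card_imset _ restr_inj); apply: eq_card => -[f1 f2].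
apply/imsetP/idP => [[f] | f12].
  by rewrite inE restrE => fin ->.
(* The glued vertex takes its color from [f1]. This agrees with [f2], since both give it the color
   [c]. *)
pose f : {ffun H -> 'I_k} :=
  [ffun x : H => match x with inl u => f1 u | inr w => f2 (val w) end].
have fE : restr f = (f1, f2).
  congr pair; apply/ffunP=> v; rewrite !ffunE //=.
  rewrite /fglue2; case: insubP => [w _ <- //|]; rewrite negbK => /eqP->.
  move: f12; rewrite in_setX ![_ \in special_colorings _ _ _ _]inE /=.
  by case/andP=> /and3P[_ _ /eqP->] /and3P[_ /eqP->].
by exists f; rewrite ?fE // inE restrE fE.
Qed.

End Step.

Lemma farey_special_adj (n : nat) :
  adj (st_X (farey n)) (st_Y (farey n)).
Proof. by case: n => [|n] //; apply: farey_step_special_adj. Qed.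

Lemma card_special_colorings_edge (k : nat) (a b : 'I_k) : a != b ->
  #|special_colorings single_edge k a b| = 1%N.
Proof.
move=> ab; pose f : {ffun single_edge -> 'I_k} :=
  [ffun x : bool => if x then b else a].
rewrite -(cards1 f); apply: eq_card => g; rewrite in_set1 inE.
apply/andP/eqP => [[_ /andP[/eqP gX /eqP gY]]|->].
  by apply/ffunP=> -[]; rewrite ffunE.
split; last by rewrite !ffunE !eqxx.
by apply/proper_coloringP=> -[] [] // _; rewrite !ffunE // eq_sym.
Qed.

(** Two distinct colors force [k >= 2], so [k.-2] is the true number of colors other than [a] and
    [b]. *)
Lemma sum_special_colors (k N : nat) (a b : 'I_k) (F : 'I_k -> nat) : a != b ->
  (forall c, F c = if (c != a) && (c != b) then N else 0)%N ->
  (\sum_c F c = k.-2 * N)%N.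
Proof.
move=> ab FE; rewrite (eq_bigr _ (fun c _ => FE c)) -big_mkcond sum_nat_const /=.
congr (_ * _)%N; have := cardsC [set a; b]; rewrite cards2 ab card_ord.
have -> : #|~: [set a; b]| = #|[pred c | (c != a) && (c != b)]|.
  by apply: eq_card => c; rewrite !inE negb_or.
by move=> /(congr1 (fun m => m.-2)).
Qed.

Lemma card_special_colorings_farey (n k : nat) (a b : 'I_k) :
  #|special_colorings (farey n) k a b| =
  (if a != b then k.-2 ^ (2 ^ n).-1 else 0)%N.
Proof.
elim: n a b => [|n IHn] a b.
(* For [a = b] a coloring would give the adjacent special vertices the same color. *)
all: have [<-|ab] /= := eqVneq a b; first (apply/eqP; rewrite cards_eq0;
  apply/set0Pn=> -[f]; rewrite inE => /andP[/proper_coloringP fP /andP[/eqP fX /eqP fY]]).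
- by have := fP _ _ (farey_special_adj 0); rewrite /= in fX fY *; rewrite fX fY eqxx.
- by rewrite card_special_colorings_edge.
- by have := fP _ _ (farey_special_adj n.+1); rewrite /= in fX fY *; rewrite fX fY eqxx.
rewrite card_special_colorings_step //.
(* By induction the terms with [c = a] or [c = b] vanish and all others are equal. The exponents add
   up as $1 + 2(2^n - 1) = 2^{n+1} - 1$. *)
rewrite (sum_special_colors _ (k.-2 ^ (2 ^ n).-1 * k.-2 ^ (2 ^ n).-1) a b) // => [|c].
  rewrite -expnD -expnS; congr (_ ^ _)%N.
  by have := expn_gt0 2 n; rewrite expnS; lia.
rewrite !IHn eq_sym; by case: (c != a); case: (c != b); rewrite ?muln0.
Qed.

Lemma card_proper_colorings_farey (n k : nat) :
  #|proper_colorings (farey n) k| = (k * (k.-1 * k.-2 ^ (2 ^ n).-1))%N.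
Proof.
rewrite card_proper_colorings -[X in (X * _)%N]card_ord -sum_nat_const.
apply: eq_bigr => a _.
under eq_bigr => b _ do rewrite card_special_colorings_farey.
rewrite -big_mkcond sum_nat_const /=; congr (_ * _)%N.
have := cardC1 a; rewrite card_ord => <-.
by apply: eq_card => b; rewrite !inE eq_sym.
Qed.

Lemma chromatic_poly_farey (n : nat) :
  chromatic_poly (farey n) = 'X * ('X - 1) * ('X - 2%:R) ^+ (2 ^ n).-1.
Proof.
apply: is_chromatic_poly_uniq (chromatic_polyP (farey n)) _ => k k_gt0.
rewrite !hornerE card_proper_colorings_farey.
(* At [k = 1] the truncated [k.-2] is 0 whereas ['X - 2%:R] takes the value $-1$; both sides still
   vanish through the factor $k - 1$. *)
case: k k_gt0 => [|[|k]] // _; first by rewrite subrr mulr0 mul0r.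
rewrite !natrM natrX mulrA; congr (_ * _ * _ ^+ _).
  by rewrite /= -[k.+2]addn1 natrD addrK.
by rewrite /= -[k.+2]addn2 natrD (addrK (1 + 1)).
Qed.

(** The case [n = 0] is separate: the exponent $2^0 - 1 = 0$ is even, so the sign of $1 - \lambda$
    is not compensated, and a single edge has polynomial $\lambda(\lambda - 1)$. *)
Theorem mainTheorem6 :
  (forall n : nat, (0 < n)%N ->
     chromatic_poly (farey n) = 'X * (1 - 'X) * (2%:R - 'X) ^+ (2 ^ n - 1))
  /\ chromatic_poly (farey 0) = 'X * ('X - 1).
Proof.
split=> [n n_gt0|]; last by rewrite chromatic_poly_farey mulr1.
(* The exponent is odd, so both factors change sign together. *)
have odd_exp : odd (2 ^ n).-1.
  by have := oddX 2 n; case: (2 ^ n)%N (expn_gt0 2 n) => //= m _; case: n n_gt0 => //= ? _ /negbFE.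
rewrite chromatic_poly_farey subn1 -[2%:R - 'X]opprB exprNn -signr_odd odd_exp expr1.
by rewrite -[1 - 'X]opprB mulN1r !(mulrN, mulNr) opprK.
Qed.
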